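(* Let $n\ge 1$ and let $M_n$ be the monoid given by the monoid presentation with generators $f_i$ ($1\le i\le n$) and $e_i$ ($1\le i\le n-1$), and defining relations (for all indices for which the generators involved exist): \begin{align*} e_i^2&=e_i, &&\\ e_ie_j&=e_je_i && (|i-j|\ge 2),\\ e_ie_{i+1}e_i&=e_{i+1}e_i, &&\\ e_{i+1}e_ie_{i+1}&=e_{i+1}e_i, &&\\ f_i^2&=f_i, &&\\ f_if_j&=f_jf_i, &&\\ f_je_i&=e_if_j && (j<i \text{ or } j>i+1),\\ f_{i+1}e_i&=f_{i+1}, &&\\ e_if_{i+1}&=e_i, &&\\ e_if_i&=f_if_{i+1}. && \end{align*} Then $M_n$ is isomorphic to $PC_n$.
   Context: $[n]=\{1,\dots,n\}$ with its natural linear order. Partial maps act on the right and are composed from left to right: $x(\alpha\beta)=(x\alpha)\beta$ whenever defined. A partial map $\alpha$ of $[n]$ is order-decreasing if $x\alpha\le x$ for all $x\in\mathrm{dom}(\alpha)$, and order-preserving if $x\alpha\le y\alpha$ for all $x\le y$ in $\mathrm{dom}(\alpha)$. $PC_n$ is the monoid (under composition) of all partial order-preserving and order-decreasing maps of $[n]$ (including the empty map). For a set $A$ and $R\subseteq A^*\times A^*$, the monoid presentation $\langle A:R\rangle$ denotes the quotient of the free monoid $A^*$ by the congruence generated by $R$. *)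

(* Defs.v *)
From HB Require Import structures.
From mathcomp Require Import boolp.
From mathcomp Require Import all_boot.
Set Implicit Arguments. Unset Strict Implicit. Unset Printing Implicit Defensive.

Section Presentation.
Local Open Scope quotient_scope.
Variables (A : choiceType) (R : seq A -> seq A -> Prop).

Inductive congr_gen : seq A -> seq A -> Prop :=
| congr_rel u v : R u v -> congr_gen u v
| congr_refl u : congr_gen u u
| congr_sym u v : congr_gen u v -> congr_gen v u
| congr_trans v u w : congr_gen u v -> congr_gen v w -> congr_gen u w
| congr_cat u1 v1 u2 v2 :
    congr_gen u1 v1 -> congr_gen u2 v2 -> congr_gen (u1 ++ u2) (v1 ++ v2).

(* The quotient library works with boolean relations, hence the classical
   reflection of the congruence. *)
Definition congr_genb : rel (seq A) := fun u v => `[< congr_gen u v >].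

Lemma congr_genb_refl : reflexive congr_genb.
Proof. by move=> u; apply/asboolP; exact: congr_refl. Qed.

Lemma congr_genb_sym : symmetric congr_genb.
Proof. by move=> u v; apply/asboolP/asboolP; exact: congr_sym. Qed.

Lemma congr_genb_trans : transitive congr_genb.
Proof.
by move=> v u w /asboolP uv /asboolP vw; apply/asboolP; exact: congr_trans vw.
Qed.

Canonical congr_genb_equiv :=
  EquivRel congr_genb congr_genb_refl congr_genb_sym congr_genb_trans.

Definition presented : Type := {eq_quot congr_genb}.

HB.instance Definition _ := Choice.on presented.
HB.instance Definition _ := EqQuotient.on presented.

Definition pclass (u : seq A) : presented := \pi_presented u.

Definition presented_one : presented := pclass [::].

Definition presented_mul (x y : presented) : presented :=
  pclass (repr x ++ repr y).

Lemma pclassP u v : pclass u = pclass v <-> congr_gen u v.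
Proof.
split=> [/eqP|uv]; first by rewrite eqmodE => /asboolP.
by apply/eqP; rewrite eqmodE; apply/asboolP.
Qed.

Lemma repr_pclass u : congr_gen (repr (pclass u)) u.
Proof. by apply/pclassP; rewrite /pclass reprK. Qed.

Lemma pclass_cat u v : presented_mul (pclass u) (pclass v) = pclass (u ++ v).
Proof. by apply/pclassP; apply: congr_cat; exact: repr_pclass. Qed.

Lemma presentedW (P : presented -> Prop) :
  (forall u, P (pclass u)) -> forall x, P x.
Proof. by move=> Pu x; rewrite -[x]reprK; exact: Pu. Qed.

Lemma presented_mulA : associative presented_mul.
Proof.
elim/presentedW=> u; elim/presentedW=> v; elim/presentedW=> w.
by rewrite !pclass_cat catA.
Qed.

Lemma presented_mul1x : left_id presented_one presented_mul.
Proof. by elim/presentedW=> u; rewrite pclass_cat. Qed.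

Lemma presented_mulx1 : right_id presented_one presented_mul.
Proof. by elim/presentedW=> u; rewrite pclass_cat cats0. Qed.

HB.instance Definition _ :=
  isMonoid.Build presented presented_mulA presented_mul1x presented_mulx1.

End Presentation.

(* Partial maps of [n]; [n] is 'I_n, so indices are shifted to start at 0. *)
Definition pmap_of (n : nat) : Type := {ffun 'I_n -> option 'I_n}.

HB.instance Definition _ n := Finite.on (pmap_of n).

Definition pmap_one n : pmap_of n := [ffun x => Some x].

(* Composition from left to right: first [a], then [b]. *)
Definition pmap_mul n (a b : pmap_of n) : pmap_of n :=
  [ffun x => obind b (a x)].

Lemma pmap_mulA n : associative (@pmap_mul n).
Proof.
move=> a b c; apply/ffunP=> x; rewrite !ffunE.
by case: (a x) => //= y; rewrite ffunE.
Qed.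

Lemma pmap_mul1x n : left_id (@pmap_one n) (@pmap_mul n).
Proof. by move=> a; apply/ffunP=> x; rewrite !ffunE. Qed.

Lemma pmap_mulx1 n : right_id (@pmap_one n) (@pmap_mul n).
Proof.
by move=> a; apply/ffunP=> x; rewrite ffunE; case: (a x) => //= y; rewrite ffunE.
Qed.

HB.instance Definition _ n :=
  isMonoid.Build (pmap_of n) (@pmap_mulA n) (@pmap_mul1x n) (@pmap_mulx1 n).

Definition order_decreasing n (a : pmap_of n) : bool :=
  [forall x, forall y, (a x == Some y) ==> (y <= x)].

Definition order_preserving n (a : pmap_of n) : bool :=
  [forall x1, forall x2, forall y1, forall y2,
     [&& a x1 == Some y1, a x2 == Some y2 & x1 <= x2] ==> (y1 <= y2)].

Definition PC_pred n (a : pmap_of n) : bool :=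
  order_preserving a && order_decreasing a.

Lemma order_decreasingP n (a : pmap_of n) :
  reflect (forall x y, a x = Some y -> y <= x) (order_decreasing a).
Proof.
apply: (iffP forallP) => [H x y /eqP axy|H x].
  by move/forallP/(_ y): (H x); rewrite axy.
by apply/forallP=> y; apply/implyP=> /eqP; exact: H.
Qed.

Lemma order_preservingP n (a : pmap_of n) :
  reflect (forall x1 x2 y1 y2, a x1 = Some y1 -> a x2 = Some y2 ->
             x1 <= x2 -> y1 <= y2) (order_preserving a).
Proof.
apply: (iffP idP) => [H x1 x2 y1 y2 /eqP a1 /eqP a2 x12|H].
  move/forallP/(_ x1)/forallP/(_ x2)/forallP/(_ y1)/forallP/(_ y2): H.
  by rewrite a1 a2 x12.
apply/forallP=> x1; apply/forallP=> x2; apply/forallP=> y1; apply/forallP=> y2.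
by apply/implyP=> /and3P[/eqP a1 /eqP a2]; exact: H a1 a2.
Qed.

Lemma pmap_mul_Some n (a b : pmap_of n) x z :
  (a * b)%g x = Some z -> exists2 y, a x = Some y & b y = Some z.
Proof. by rewrite ffunE; case: (a x) => //= y; exists y. Qed.

Lemma PC_monoid_closed n : monoid_closed (@PC_pred n).
Proof.
split=> [|a b].
  apply/andP; split.
    by apply/order_preservingP => x1 x2 y1 y2; rewrite !ffunE => -[<-] [<-].
  by apply/order_decreasingP => x y; rewrite ffunE => -[<-].
move=> /andP[/order_preservingP pa /order_decreasingP da].
move=> /andP[/order_preservingP pb /order_decreasingP db].
apply/andP; split.
  apply/order_preservingP => x1 x2 z1 z2.
  move=> /pmap_mul_Some[y1 a1 b1] /pmap_mul_Some[y2 a2 b2] x12.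
  exact: pb b1 b2 (pa _ _ _ _ a1 a2 x12).
apply/order_decreasingP => x z /pmap_mul_Some[y axy byz].
exact: leq_trans (db _ _ byz) (da _ _ axy).
Qed.

Record PC (n : nat) : Type := PCMap {
  PC_val :> pmap_of n;
  PC_valP : PC_pred PC_val
}.

HB.instance Definition _ n := [isSub for @PC_val n].
HB.instance Definition _ n := [Finite of PC n by <:].
HB.instance Definition _ n :=
  SubChoice_isSubMonoid.Build (pmap_of n) (@PC_pred n) (PC n)
    (@PC_monoid_closed n).

(* [inl i] is f_(i+1) for i < n, and [inr i] is e_(i+1) for i < n - 1. *)
Definition gen (n : nat) : Type := ('I_n + 'I_n.-1)%type.

HB.instance Definition _ n := Finite.on (gen n).

Definition fgen n (i : 'I_n) : gen n := inl i.
Definition egen n (i : 'I_n.-1) : gen n := inr i.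

Inductive Mrel (n : nat) : seq (gen n) -> seq (gen n) -> Prop :=
| Mrel_ee (i : 'I_n.-1) :
    Mrel [:: egen i; egen i] [:: egen i]
| Mrel_eC (i j : 'I_n.-1) : (i + 2 <= j) || (j + 2 <= i) ->
    Mrel [:: egen i; egen j] [:: egen j; egen i]
| Mrel_eSe (i j : 'I_n.-1) : j = i + 1 :> nat ->
    Mrel [:: egen i; egen j; egen i] [:: egen j; egen i]
| Mrel_SeS (i j : 'I_n.-1) : j = i + 1 :> nat ->
    Mrel [:: egen j; egen i; egen j] [:: egen j; egen i]
| Mrel_ff (i : 'I_n) :
    Mrel [:: fgen i; fgen i] [:: fgen i]
| Mrel_fC (i j : 'I_n) :
    Mrel [:: fgen i; fgen j] [:: fgen j; fgen i]
| Mrel_feC (i : 'I_n.-1) (j : 'I_n) : (j < i) || (i + 1 < j) ->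
    Mrel [:: fgen j; egen i] [:: egen i; fgen j]
| Mrel_fSe (i : 'I_n.-1) (j : 'I_n) : j = i + 1 :> nat ->
    Mrel [:: fgen j; egen i] [:: fgen j]
| Mrel_efS (i : 'I_n.-1) (j : 'I_n) : j = i + 1 :> nat ->
    Mrel [:: egen i; fgen j] [:: egen i]
| Mrel_ef (i : 'I_n.-1) (j k : 'I_n) : j = i :> nat -> k = i + 1 :> nat ->
    Mrel [:: egen i; fgen j] [:: fgen j; fgen k].

Definition M (n : nat) : Type := presented (@Mrel n).

HB.instance Definition _ n := Monoid.on (M n).

(* Main.v *)
(** Every element of PC_n is the product, over x = 1, ..., n in this order, of
    the blocks e_(x-1) e_(x-2) ... e_(x alpha), with the block f_x when x is not
    in the domain: earlier blocks fix x, and later ones fix x alpha because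
    alpha is order-preserving. So the evaluation M_n -> PC_n is onto. It is
    injective because the relations rewrite the normal form of alpha times a
    generator g into the normal form of alpha g: g moves left through the blocks,
    altering those x with x alpha moved by g, until a block absorbs it. *)

Require Import Defs.
From mathcomp Require Import all_boot.
From mathcomp Require Import zify.

(** * Normal forms in a monoid satisfying the relations, for families [E] and [F] indexed by all
    natural numbers from 0 *)

Section NormalForm.
Local Open Scope group_scope.
Variables (G : monoidType) (E F : nat -> G).
Hypothesis EE : forall i, E i * E i = E i.
Hypothesis EC : forall i j, (i.+1 < j) || (j.+1 < i) -> E i * E j = E j * E i.
Hypothesis ESE : forall i, E i * E i.+1 * E i = E i.+1 * E i.
Hypothesis SES : forall i, E i.+1 * E i * E i.+1 = E i.+1 * E i.
Hypothesis FF : forall i, F i * F i = F i.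
Hypothesis FC : forall i j, F i * F j = F j * F i.
Hypothesis FEC :
  forall i j, (j < i) || (i.+1 < j) -> F j * E i = E i * F j.
Hypothesis FSE : forall i, F i.+1 * E i = F i.+1.
Hypothesis EFS : forall i, E i * F i.+1 = E i.
Hypothesis EF : forall i, E i * F i = F i * F i.+1.

(** The descending product [E (y-1) * ... * E a], empty when [y <= a]. As a map it collapses the
    interval from [a] to [y] onto [a]. *)
Fixpoint Edown (y a : nat) : G :=
  if y is y'.+1 then if a <= y' then E y' * Edown y' a else 1 else 1.

Lemma Edown_ge y a : y <= a -> Edown y a = 1.
Proof. by case: y => //= y; case: leqP => //; lia. Qed.

Lemma EdownSr y a : a < y -> Edown y a = Edown y a.+1 * E a.
Proof.
elim: y => //= y IH; rewrite ltnS => ay; rewrite ay.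
move: ay; rewrite leq_eqVlt => /predU1P[->|ay].
  by rewrite ltnn Edown_ge // mulg1 mul1g.
by rewrite ay IH // mulgA.
Qed.

Lemma Edown_commE y a i : (i.+1 < a) || (y < i) ->
  Edown y a * E i = E i * Edown y a.
Proof.
elim: y => [|y IH] /= yai; first by rewrite mulg1 mul1g.
case: leqP => ay; last by rewrite mulg1 mul1g.
by rewrite -mulgA IH ?mulgA ?[E i * E y]EC //; lia.
Qed.

Lemma Edown_commF y a i : (i < a) || (y < i) ->
  Edown y a * F i = F i * Edown y a.
Proof.
elim: y => [|y IH] /= yai; first by rewrite mulg1 mul1g.
case: leqP => ay; last by rewrite mulg1 mul1g.
by rewrite -mulgA IH ?mulgA ?FEC //; lia.
Qed.

(** [E i] moves left past the factors of index below [i-1]; then [SES] absorbs it, or [EE] when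
    [i = a]. *)
Lemma Edown_mulE y a i : a <= i < y -> Edown y a * E i = Edown y a.
Proof.
elim: y => [|y IH] /andP[ai] //; rewrite ltnS leq_eqVlt => /predU1P[<-|iy] /=.
  rewrite ai; case: i ai {IH} => [|i] ai /=; first by rewrite mulg1 EE.
  case: leqP => ai'; last by rewrite mulg1 EE.
  by rewrite -!mulgA Edown_commE ?mulgA ?SES //; lia.
by have -> : a <= y by [lia]; rewrite -mulgA IH // ai.
Qed.

(** [E i] moves right past the factors of index above [i.+1], and [ESE] absorbs it into the last two
    factors. *)
Lemma E_mulEdown y i : i < y -> E i * Edown y i = Edown y i.
Proof.
elim: y => [|y IH] //; rewrite ltnS leq_eqVlt => /predU1P[<-|iy] /=.
  by rewrite leqnn Edown_ge // mulg1 EE.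
rewrite ltnW //; move: iy; rewrite leq_eqVlt => /predU1P[<-|iy] /=.
  by rewrite leqnn Edown_ge // mulg1 mulgA ESE.
by rewrite mulgA EC ?iy // -mulgA IH // ltnW.
Qed.

(** [F i] moves left until it meets [E (i-1)], which absorbs it by [EFS]. *)
Lemma Edown_mulF y a i : a < i <= y -> Edown y a * F i = Edown y a.
Proof.
elim: y => [|y IH] /andP[ai]; first by lia.
rewrite leq_eqVlt => /predU1P[iE|iy] /=.
  have -> : a <= y by lia.
  by rewrite -mulgA Edown_commF ?mulgA ?iE ?EFS //; lia.
by have -> : a <= y by [lia]; rewrite -mulgA IH // ai.
Qed.

(* [Edown y i * F i = F i * F i.+1 * ... * F y]; the hypothesis on [X] removes
   the inner factors. *)
Lemma mul_Edown_F X y i : i <= y ->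
    (forall j, i < j < y -> X * F j = X) ->
  X * Edown y i * F i = X * F i * F y.
Proof.
move=> iy; have [d yE] : exists d, y = i + d by exists (y - i); lia.
elim: d => [|d IH] in X i iy yE * => XF.
  have -> : y = i by lia.
  by rewrite Edown_ge // mulg1 -mulgA FF.
(* Peel off the lowest factor, turn [E i * F i] into [F i * F i.+1], and move [F i] left to [X]. The
   induction hypothesis then applies to [X * F i] and [i.+1]. *)
rewrite EdownSr; last by lia.
rewrite -!mulgA EF (mulgA (Edown _ _)) (Edown_commF y i.+1 i); last by lia.
rewrite -(mulgA (F i)) 2!(mulgA _ (F i)) ?mulgA IH; try lia.
  have [->|yi] := eqVneq y i.+1; first by rewrite -(mulgA (X * F i)) FF.
  by rewrite -(mulgA X (F i) (F i.+1)) FC mulgA (XF i.+1) //; lia.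
by move=> j ij; rewrite -mulgA FC mulgA XF //; lia.
Qed.

Definition block (x : nat) (o : option nat) : G :=
  if o is Some y then Edown x y else F x.

Fixpoint nform (a : nat -> option nat) (k : nat) : G :=
  if k is k'.+1 then nform a k' * block k' (a k') else 1.

Lemma eq_nform a b k : (forall x, x < k -> a x = b x) -> nform a k = nform b k.
Proof.
elim: k => //= k IH ab; rewrite ab // IH // => x xk.
by rewrite ab // ltnS ltnW.
Qed.

(** Right multiplication by a generator changes only the values of a map, so it is an operation on
    one optional value, [None] meaning undefined. *)
Definition actE (i : nat) : option nat -> option nat :=
  omap (fun y => if y == i.+1 then i else y).

Definition actF (i : nat) : option nat -> option nat :=
  obind (fun y => if y == i then None else Some y).

Definition decreasing (a : nat -> option nat) :=
  forall x y, a x = Some y -> y <= x.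

Definition preserving (a : nat -> option nat) :=
  forall x1 x2 y1 y2, a x1 = Some y1 -> a x2 = Some y2 ->
    x1 <= x2 -> y1 <= y2.

(** Since [E i] moves the point [i.+1], block [i.+1] must already be present; hence the bound on
    [k]. *)
Lemma nform_actE a k i : decreasing a -> preserving a -> i.+1 < k ->
  nform a k * E i = nform (actE i \o a) k.
Proof.
move=> da pa; elim: k => //= k IH; rewrite ltnS => ik.
(* If no earlier value exceeds [i], the earlier blocks do not change. *)
have stable : (forall x y, x < k -> a x = Some y -> y <= i) ->
    nform a k = nform (actE i \o a) k.
  move=> small; apply: eq_nform => x xk /=.
  case ax: (a x) => [y|] //=; case: eqP => // yi.
  by have := small x y xk ax; lia.
move: ik; rewrite leq_eqVlt => /predU1P[kE|ik].
  have {}stable : nform a k = nform (actE i \o a) k.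
    by apply: stable => x y xk /da; lia.
  rewrite -stable -mulgA -kE; congr (_ * _).
  case aE: (a i.+1) => [y|] /=; last exact: FSE.
  case: eqP => [->|yi] /=; first by rewrite ltnn leqnn Edown_ge // mulg1 mul1g.
  by rewrite (Edown_mulE i.+1) //; have := da _ _ aE; lia.
rewrite -mulgA; case aE: (a k) => [y|] /=; last first.
  by rewrite FEC ?ik ?orbT // mulgA IH.
case: eqP => [->|yi].
  (* The new block [Edown k i] can emit a further [E i] on its left, which updates the earlier
     blocks by induction. *)
  by rewrite -EdownSr ?(ltnW ik) // -IH // -mulgA E_mulEdown // ltnW.
have [yi'|iy] := leqP y i.
  rewrite Edown_mulE ?yi' ?(ltnW ik) ?stable //.
  by move=> x z xk ax; have := pa _ _ _ _ ax aE (ltnW xk); lia.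
by rewrite Edown_commE ?mulgA ?IH //; lia.
Qed.

Lemma nform_actF a k i : decreasing a -> preserving a -> i < k ->
  nform a k * F i = nform (actF i \o a) k.
Proof.
move=> da pa; elim: k i => //= k IH i; rewrite ltnS => ik.
have stable j : (forall x y, x < k -> a x = Some y -> y != j) ->
    nform a k = nform (actF j \o a) k.
  move=> small; apply: eq_nform => x xk /=.
  by case ax: (a x) => [y|] //=; rewrite (negPf (small x y xk ax)).
rewrite -mulgA; case aE: (a k) => [y|] /=; last first.
  move: ik; rewrite leq_eqVlt => /predU1P[kE|ik].
    rewrite kE FF [in LHS](stable k) // => x y xk /da; lia.
  by rewrite FC mulgA IH.
have yk := da _ _ aE.
have small x z : x < k -> a x = Some z -> z <= y.
  by move=> xk ax; apply: pa ax aE (ltnW xk).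
have [yi|yi] := eqVneq y i.
  rewrite yi /= mulgA mul_Edown_F //.
    move: ik; rewrite leq_eqVlt => /predU1P[kE|ik]; last by rewrite IH.
    rewrite -mulgA kE FF [in LHS](stable k) // => x z xk /da; lia.
  (* Earlier values are at most [i], so [F j] acts trivially on them for [i < j < k]. This uses the
     induction hypothesis at [j], hence the induction with [i] general. *)
  move=> j jk; rewrite IH -?stable //; last by lia.
  by move=> x z xk /(small _ _ xk); lia.
have [iy|iy] := ltnP i y.
  by rewrite Edown_commF ?iy // mulgA IH //; lia.
rewrite Edown_mulF -?stable //; last by lia.
by move=> x z xk /(small _ _ xk); lia.
Qed.

End NormalForm.

Arguments Edown {G} E y a.
Arguments nform {G} E F a k.

(** * Evaluation of words and classes in [PC n] *)

Definition actg {n} (g : gen n) : option nat -> option nat :=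
  match g with inl i => actF i | inr i => actE i end.

(** Soundness of the relations, checked value by value: on natural numbers each one is a case
    analysis on equalities of indices. *)
Lemma actg_congr {n} (u v : seq (gen n)) : congr_gen (@Mrel n) u v ->
  forall o, foldl (fun o g => actg g o) o u = foldl (fun o g => actg g o) o v.
Proof.
elim=> {u v}; last 4 first.
- by [].
- by move=> u v _ IH o; rewrite IH.
- by move=> u v w _ IHu _ IHv o; rewrite IHu.
- by move=> u1 v1 u2 v2 _ IH1 _ IH2 o; rewrite !foldl_cat IH1 IH2.
move=> u v uv [y|]; case: uv => //= *; rewrite /actF /actE /=;
  repeat case: (y =P _) => /= ?;
  repeat case: (nat_of_ord _ =P _) => /= ?;
  first [by [] | by congr Some; lia | by lia].
Qed.

Definition lower {n} (i : 'I_n.-1) : 'I_n := widen_ord (leq_pred n) i.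

Definition gen_pmap {n} (g : gen n) : pmap_of n :=
  match g with
  | inl i => [ffun x => if x == i then None else Some x]
  | inr i => [ffun x : 'I_n => Some (if x == i.+1 :> nat then lower i else x)]
  end.

Lemma gen_pmap_PC {n} (g : gen n) : PC_pred (gen_pmap g).
Proof.
apply/andP; split; first apply/order_preservingP; last apply/order_decreasingP;
  case: g => i /=.
- move=> x1 x2 y1 y2; rewrite !ffunE.
  by do 2![case: eqP => // _]; move=> [<-] [<-].
- move=> x1 x2 y1 y2; rewrite !ffunE => -[<-] [<-].
  by repeat case: eqP => /= *; lia.
- by move=> x y; rewrite ffunE; case: eqP => // _ [<-].
- by move=> x y; rewrite ffunE => -[<-]; case: eqP => /= *; lia.
Qed.

Definition gen_PC {n} (g : gen n) : PC n := PCMap (gen_pmap_PC g).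

(** Extension by [None] outside the range, so that normal forms need no ordinals. *)
Definition pmap_nat {n} (a : pmap_of n) (x : nat) : option nat :=
  obind (fun x : 'I_n => omap val (a x)) (insub x).

Lemma pmap_nat_inj {n} (a b : pmap_of n) :
  (forall x, x < n -> pmap_nat a x = pmap_nat b x) -> a = b.
Proof.
move=> ab; apply/ffunP=> x; have := ab x (ltn_ord x).
rewrite /pmap_nat valK /=; case: (a x) (b x) => [y|] [z|] //= [yz].
by congr Some; apply: val_inj.
Qed.

Lemma pmap_nat_ltn {n} (a : pmap_of n) x y : pmap_nat a x = Some y -> y < n.
Proof.
rewrite /pmap_nat; case: insubP => //= x' _ _.
by case: (a x') => //= y' [<-].
Qed.

Lemma pmap_nat_decreasing {n} (a : PC n) : decreasing (pmap_nat a).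
Proof.
have /andP[_ /order_decreasingP da] := PC_valP a.
move=> x y; rewrite /pmap_nat; case: insubP => //= x' _ <-.
by case ax: (PC_val a x') => [y'|] //= [<-]; apply: da.
Qed.

Lemma pmap_nat_preserving {n} (a : PC n) : preserving (pmap_nat a).
Proof.
have /andP[/order_preservingP pa _] := PC_valP a.
move=> x1 x2 y1 y2; rewrite /pmap_nat.
case: insubP => //= x1' _ <-; case ax1: (PC_val a x1') => [y1'|] //= [<-].
case: insubP => //= x2' _ <-; case ax2: (PC_val a x2') => [y2'|] //= [<-].
exact: pa.
Qed.

Lemma pmap_nat1 {n} x : x < n -> pmap_nat (1%g : PC n) x = Some x.
Proof.
move=> xn; rewrite /pmap_nat; case: insubP => [x' _ <-|]; last by rewrite xn.
by rewrite /= ffunE.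
Qed.

Lemma pmap_nat_mul {n} (a : PC n) g x :
  pmap_nat (a * gen_PC g)%g x = actg g (pmap_nat a x).
Proof.
rewrite /pmap_nat; case: insubP => [x' _ _|_] /=; last by case: g.
rewrite ffunE; case: (PC_val a x') => [y|] /=; last by case: g.
case: g => i /=; rewrite ffunE /actF /actE /=; last by case: eqP.
by rewrite -val_eqE /=; case: eqP.
Qed.

Definition word_PC {n} (u : seq (gen n)) : PC n := (\prod_(g <- u) gen_PC g)%g.

Lemma pmap_nat_word {n} (u : seq (gen n)) x : x < n ->
  pmap_nat (word_PC u) x = foldl (fun o g => actg g o) (Some x) u.
Proof.
move=> xn; elim/last_ind: u => [|u g IH].
  by rewrite /word_PC big_nil pmap_nat1.
by rewrite /word_PC big_rcons /= pmap_nat_mul IH foldl_rcons.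
Qed.

Lemma word_PC_congr {n} (u v : seq (gen n)) :
  congr_gen (@Mrel n) u v -> word_PC u = word_PC v.
Proof.
move=> uv; apply: val_inj; apply: pmap_nat_inj => x xn.
by rewrite !pmap_nat_word // (actg_congr u v uv).
Qed.

Definition M_PC {n} (m : M n) : PC n := word_PC (repr m).

Lemma M_PC_pclass {n} u : M_PC (pclass (@Mrel n) u) = word_PC u.
Proof. exact/word_PC_congr/repr_pclass. Qed.

Lemma M_PC_morphism {n} : monoid_morphism (@M_PC n).
Proof.
split=> [|x y].
  by rewrite [1%g]/(pclass _ _) M_PC_pclass /word_PC big_nil.
elim/presentedW: x => u; elim/presentedW: y => v.
by rewrite [(_ * _)%g]pclass_cat !M_PC_pclass /word_PC big_cat.
Qed.

(* The value 1 out of range is consistent with every defining relation, which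
   therefore hold below without range conditions on the indices. *)
Definition Egen n (i : nat) : M n :=
  if insub i is Some j then pclass _ [:: egen j] else 1%g.

Definition Fgen n (i : nat) : M n :=
  if insub i is Some j then pclass _ [:: fgen j] else 1%g.

(** * The defining relations for the totalised generators of [M n] *)

Section Relations.
Local Open Scope group_scope.
Variable n : nat.
Notation E := (Egen n).
Notation F := (Fgen n).

Lemma pclassM u v : pclass (@Mrel n) u * pclass _ v = pclass _ (u ++ v) :> M n.
Proof. exact: pclass_cat. Qed.

Lemma pclass_rel u v : Mrel u v -> pclass (@Mrel n) u = pclass _ v.
Proof. by move=> uv; apply/pclassP/congr_rel. Qed.

Lemma Egen_idem i : E i * E i = E i.
Proof.
rewrite /Egen; case: insubP => [j _ _|_]; last exact: mulg1.
by rewrite pclassM; apply/pclass_rel/Mrel_ee.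
Qed.

Lemma EgenC i j : (i.+1 < j) || (j.+1 < i) -> E i * E j = E j * E i.
Proof.
rewrite /Egen; case: insubP => [i' _ <-|_]; last by rewrite mulg1 mul1g.
case: insubP => [j' _ <-|_]; last by rewrite mulg1 mul1g.
by move=> ij; rewrite !pclassM; apply/pclass_rel/Mrel_eC; rewrite !addn2.
Qed.

Lemma Egen_ESE i : E i * E i.+1 * E i = E i.+1 * E i.
Proof.
rewrite {2 4}/Egen; case: insubP => [j _ /= ji|_].
  rewrite /Egen; case: insubP => [i' _ /= i'E|/negP[]];
    last by have := ltn_ord j; lia.
  by rewrite !(pclassM [:: _] [:: _]) (pclassM [:: _; _]);
     apply/pclass_rel/Mrel_eSe; lia.
(* With [E i.+1 = 1] the relation reduces to idempotency of [E i]. *)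
by rewrite mulg1 mul1g Egen_idem.
Qed.

Lemma Egen_SES i : E i.+1 * E i * E i.+1 = E i.+1 * E i.
Proof.
rewrite {1 3 4}/Egen; case: insubP => [j _ /= ji|_]; last by rewrite mulg1.
rewrite /Egen; case: insubP => [i' _ /= i'E|/negP[]];
  last by have := ltn_ord j; lia.
by rewrite !(pclassM [:: _] [:: _]) (pclassM [:: _; _]);
   apply/pclass_rel/Mrel_SeS; lia.
Qed.

Lemma Fgen_idem i : F i * F i = F i.
Proof.
rewrite /Fgen; case: insubP => [j _ _|_]; last exact: mulg1.
by rewrite pclassM; apply/pclass_rel/Mrel_ff.
Qed.

Lemma FgenC i j : F i * F j = F j * F i.
Proof.
rewrite /Fgen; case: insubP => [i' _ _|_]; last by rewrite mulg1 mul1g.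
case: insubP => [j' _ _|_]; last by rewrite mulg1 mul1g.
by rewrite !pclassM; apply/pclass_rel/Mrel_fC.
Qed.

Lemma FgenEC i j : (j < i) || (i.+1 < j) -> F j * E i = E i * F j.
Proof.
rewrite /Fgen; case: insubP => [j' _ <-|_]; last by rewrite mulg1 mul1g.
rewrite /Egen; case: insubP => [i' _ <-|_]; last by rewrite mulg1 mul1g.
by move=> ij; rewrite !pclassM; apply/pclass_rel/Mrel_feC; rewrite addn1.
Qed.

Lemma Fgen_FSE i : F i.+1 * E i = F i.+1.
Proof.
rewrite /Egen; case: insubP => [i' _ /= i'E|_]; last exact: mulg1.
rewrite /Fgen; case: insubP => [j _ /= ji|/negP[]];
  last by have := ltn_ord i'; lia.
by rewrite pclassM; apply/pclass_rel/Mrel_fSe; lia.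
Qed.

Lemma Egen_EFS i : E i * F i.+1 = E i.
Proof.
rewrite /Fgen; case: insubP => [j _ /= ji|_]; last exact: mulg1.
rewrite /Egen; case: insubP => [i' _ /= i'E|/negP[]];
  last by have := ltn_ord j; lia.
by rewrite pclassM; apply/pclass_rel/Mrel_efS; lia.
Qed.

Lemma Egen_EF i : E i * F i = F i * F i.+1.
Proof.
rewrite {3}/Fgen; case: insubP => [j _ /= ji|ni].
  rewrite /Egen; case: insubP => [i' _ /= i'E|/negP[]];
    last by have := ltn_ord j; lia.
  rewrite /Fgen; case: insubP => [k _ /= ki|/negP[]];
    last by have := ltn_ord j; lia.
  by rewrite !pclassM; apply/pclass_rel/Mrel_ef; lia.
(* [F i.+1] and [E i] leave the range together, and then both sides are [F i]. *)
rewrite /Egen; case: insubP => [j ij _|_]; last by rewrite mul1g mulg1.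
by move: ni ij; lia.
Qed.

(** * Normal forms as the inverse of evaluation *)

Lemma M_PC_M (x y : M n) : M_PC (x * y) = M_PC x * M_PC y.
Proof. exact: M_PC_morphism.2. Qed.

Lemma pmap_nat_mulE (m : M n) i x :
  pmap_nat (M_PC (m * E i)) x = actE i (pmap_nat (M_PC m) x).
Proof.
rewrite M_PC_M /Egen; case: insubP => [j _ <-|/negP ni].
  by rewrite M_PC_pclass /word_PC big_seq1 pmap_nat_mul.
(* Out of range, [i.+1] is at least [n], so [actE i] fixes every value that occurs. *)
rewrite M_PC_morphism.1 mulg1.
case ax: (pmap_nat _ x) => [y|] //=; case: eqP => // yi.
by have := pmap_nat_ltn _ _ _ ax; move: ni; lia.
Qed.

Lemma pmap_nat_mulF (m : M n) i x :
  pmap_nat (M_PC (m * F i)) x = actF i (pmap_nat (M_PC m) x).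
Proof.
rewrite M_PC_M /Fgen; case: insubP => [j _ <-|/negP ni].
  by rewrite M_PC_pclass /word_PC big_seq1 pmap_nat_mul.
rewrite M_PC_morphism.1 mulg1.
case ax: (pmap_nat _ x) => [y|] //=; case: eqP => // yi.
by have := pmap_nat_ltn _ _ _ ax; move: ni; lia.
Qed.

Lemma pmap_nat_mul_Edown (m : M n) y a x :
  pmap_nat (M_PC (m * Edown E y a)) x =
    omap (fun z => if a <= z <= y then a else z) (pmap_nat (M_PC m) x).
Proof.
elim: y m => [|y IH] m /=.
  by rewrite mulg1; case: pmap_nat => //= z; congr Some; case: ifP; lia.
case: leqP => ay.
  rewrite mulgA IH pmap_nat_mulE; case: pmap_nat => //= z; congr Some.
  by do 3!case: ifP; lia.
by rewrite mulg1; case: pmap_nat => //= z; congr Some; case: ifP; lia.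
Qed.

Definition PC_M (a : PC n) : M n := nform E F (pmap_nat a) n.

(** Block [k] affects only the value [k], or those from the image of [k] up to [k]. Earlier points
    have smaller values or share that image; later points are still fixed above [k]. *)
Lemma pmap_nat_nform (a : PC n) k x : k <= n -> x < n ->
  pmap_nat (M_PC (nform E F (pmap_nat a) k)) x =
    if x < k then pmap_nat a x else Some x.
Proof.
move=> kn xn; elim: k kn => [|k IH] kn /=.
  by rewrite M_PC_morphism.1 pmap_nat1.
have [da pa] := (pmap_nat_decreasing a, pmap_nat_preserving a).
case ak: (pmap_nat a k) => [y|] /=; last first.
  rewrite pmap_nat_mulF IH ?ltnS; last exact: ltnW.
  case: (ltngtP x k) => xk.
  - case ax: (pmap_nat a x) => [z|] //=; case: eqP => // zk.
    by have := da _ _ ax; lia.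
  - by rewrite /=; case: eqP => //; lia.
  - by rewrite xk ak /= eqxx.
rewrite pmap_nat_mul_Edown IH ?ltnS; last exact: ltnW.
have yk := da _ _ ak.
case: (ltngtP x k) => xk.
- case ax: (pmap_nat a x) => [z|] //=; congr Some.
  by have := pa _ _ _ _ ax ak (ltnW xk); case: ifP; lia.
- by rewrite /=; congr Some; case: ifP; lia.
- by rewrite xk ak /= yk leqnn.
Qed.

Lemma PC_MK : cancel PC_M M_PC.
Proof.
move=> a; apply: val_inj; apply: pmap_nat_inj => x xn.
by rewrite pmap_nat_nform // xn.
Qed.

Lemma nform_id a k : (forall x, x < k -> a x = Some x) -> nform E F a k = 1.
Proof.
elim: k => //= k IH ak; rewrite ak // IH /= ?Edown_ge ?mulg1 // => x xk.
by rewrite ak // ltnW.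
Qed.

(** This gives injectivity: a class is determined by its map. Appending one generator is the action
    computed by [nform_actF] and [nform_actE]. *)
Lemma pclass_nform u :
  pclass (@Mrel n) u = nform E F (pmap_nat (word_PC u)) n.
Proof.
elim/last_ind: u => [|u g IH].
  by rewrite nform_id // => x xn; rewrite /word_PC big_nil pmap_nat1.
rewrite -cats1 -pclassM IH.
rewrite [RHS](eq_nform _ _ _ _ (actg g \o pmap_nat (word_PC u))); last first.
  by move=> x _; rewrite /word_PC big_cat big_seq1 pmap_nat_mul.
have [da pa] :=
  (pmap_nat_decreasing (word_PC u), pmap_nat_preserving (word_PC u)).
case: g => i.
  rewrite -[RHS]/(nform E F (actF i \o _) n) 
    -(nform_actF _ E F Fgen_idem FgenC FgenEC Egen_EFS Egen_EF) //.
  by rewrite /Fgen valK.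
rewrite -[RHS]/(nform E F (actE i \o _) n) 
  -(nform_actE _ E F Egen_idem EgenC Egen_ESE Egen_SES FgenEC Fgen_FSE) //.
  by rewrite /Egen valK.
by have := ltn_ord i; lia.
Qed.

Lemma M_PCK : cancel M_PC PC_M.
Proof.
by elim/presentedW => u; rewrite M_PC_pclass /PC_M -pclass_nform.
Qed.

End Relations.

Theorem mainTheorem4 (n : nat) (hn : 1 <= n) :
  exists2 phi : M n -> PC n, monoid_morphism phi & bijective phi.
Proof.
exists M_PC; first exact: M_PC_morphism.
by exists (@PC_M n); [exact: M_PCK | exact: PC_MK].
Qed.
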